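(* Let $D_1(n)$ denote the number of partitions of $n$ into parts congruent to $\pm1,\pm6,\pm8$ or $14\pmod{28}$ such that parts congruent to $\pm1\pmod{28}$ come in 2 colours and parts congruent to $14\pmod{28}$ come in 4 colours. Let $D_2(n)$ denote the number of partitions of $n$ into parts congruent to $\pm6,\pm8,\pm13$ or $14\pmod{28}$ such that parts congruent to $\pm13\pmod{28}$ come in 2 colours and parts congruent to $14\pmod{28}$ come in 4 colours. Let $D_3(n)$ denote the number of partitions of $n$ into parts congruent to $\pm1,\pm7$ or $\pm13\pmod{28}$, each part coming in 2 colours. Then for every integer $n\ge6$, $$D_1(n)-D_2(n-6)-D_3(n)=0.$$ Equivalently, as formal power series, $$\frac{1}{(q,q^{27};q^{28})_\infty^2(q^{14};q^{28})_\infty^4(q^6,q^{22},q^8,q^{20};q^{28})_\infty}-\frac{q^6}{(q^{13},q^{15};q^{28})_\infty^2(q^{14};q^{28})_\infty^4(q^6,q^{22},q^8,q^{20};q^{28})_\infty}=\frac{1}{(q,q^{27},q^7,q^{21},q^{13},q^{15};q^{28})_\infty^2}.$$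
   Context: $(\lambda;q)_\infty=\prod_{t\ge0}(1-\lambda q^t)$ and $(a_1,\dots,a_m;q)_\infty=\prod_j(a_j;q)_\infty$. A partition in which parts of a given residue class ''come in $r$ colours'' means each such part size has $r$ distinguishable copies; thus $1/(q^s;q^m)_\infty^r$ generates partitions into parts $\equiv s\pmod m$ with $r$ colours. Conventions: $D_i(0)=1$; ''parts congruent to $\pm a \pmod{28}$'' means parts congruent to $a$ or $28-a$ modulo 28. *)

(* Defs.v *)
From HB Require Import structures.
From mathcomp Require Import all_boot all_order all_algebra.
From mathcomp Require Import boolp.

Set Implicit Arguments.
Unset Strict Implicit.
Unset Printing Implicit Defensive.
Import GRing.Theory.

Local Open Scope nat_scope.

(** * Coloured partitions *)

(* [col k] is the number of colours available for a part of size [k]; it is 0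
   when [k] is not allowed as a part.  The element [Tagged _ c] over [i : 'I_n]
   is the part of size [i.+1] in colour [c]; parts larger than [n] cannot occur
   in a partition of [n]. *)
Definition coloured_part (col : nat -> nat) (n : nat) : finType :=
  {i : 'I_n & 'I_(col i.+1)}.

(* A coloured partition of [n] is given by the multiplicity of each coloured
   part; multiplicities never exceed [n]. *)
Definition coloured_partitions (col : nat -> nat) (n : nat) :
    {set {ffun coloured_part col n -> 'I_n.+1}} :=
  [set f : {ffun coloured_part col n -> 'I_n.+1} |
     \sum_x f x * (tag x).+1 == n].

Definition D1_colours (k : nat) : nat :=
  if k %% 28 \in [:: 1; 27] then 2
  else if k %% 28 \in [:: 6; 22; 8; 20] then 1
  else if k %% 28 == 14 then 4
  else 0.

Definition D2_colours (k : nat) : nat :=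
  if k %% 28 \in [:: 13; 15] then 2
  else if k %% 28 \in [:: 6; 22; 8; 20] then 1
  else if k %% 28 == 14 then 4
  else 0.

Definition D3_colours (k : nat) : nat :=
  if k %% 28 \in [:: 1; 27; 7; 21; 13; 15] then 2 else 0.

Definition D1 (n : nat) : nat := #|coloured_partitions D1_colours n|.
Definition D2 (n : nat) : nat := #|coloured_partitions D2_colours n|.
Definition D3 (n : nat) : nat := #|coloured_partitions D3_colours n|.

(** * The ring of formal power series *)

Local Open Scope ring_scope.

Record fps (R : comUnitRingType) := Fps { fcoef : nat -> R }.

Lemma fpsP (R : comUnitRingType) (a b : fps R) : fcoef a =1 fcoef b -> a = b.
Proof. by case: a b => [a] [b] /= /funext ->. Qed.

HB.instance Definition _ (R : comUnitRingType) := gen_eqMixin (fps R).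
HB.instance Definition _ (R : comUnitRingType) := gen_choiceMixin (fps R).

Definition fps_zero (R : comUnitRingType) : fps R := Fps (fun=> 0).
Definition fps_opp (R : comUnitRingType) (a : fps R) : fps R :=
  Fps (fun n => - fcoef a n).
Definition fps_add (R : comUnitRingType) (a b : fps R) : fps R :=
  Fps (fun n => fcoef a n + fcoef b n).
Definition fps_one (R : comUnitRingType) : fps R := Fps (fun n => (n == 0%N)%:R).
Definition fps_mul (R : comUnitRingType) (a b : fps R) : fps R :=
  Fps (fun n => \sum_(i < n.+1) fcoef a i * fcoef b (n - i)%N).

Lemma fps_addA (R : comUnitRingType) : associative (@fps_add R).
Proof. by move=> a b c; apply: fpsP => n /=; rewrite addrA. Qed.
Lemma fps_addC (R : comUnitRingType) : commutative (@fps_add R).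
Proof. by move=> a b; apply: fpsP => n /=; rewrite addrC. Qed.
Lemma fps_add0 (R : comUnitRingType) : left_id (@fps_zero R) (@fps_add R).
Proof. by move=> a; apply: fpsP => n /=; rewrite add0r. Qed.
Lemma fps_addN (R : comUnitRingType) :
  left_inverse (@fps_zero R) (@fps_opp R) (@fps_add R).
Proof. by move=> a; apply: fpsP => n /=; rewrite addNr. Qed.

HB.instance Definition _ (R : comUnitRingType) :=
  GRing.isZmodule.Build (fps R)
    (@fps_addA R) (@fps_addC R) (@fps_add0 R) (@fps_addN R).

Definition fps_trunc (R : comUnitRingType) (N : nat) (a : fps R) : {poly R} :=
  \poly_(i < N) fcoef a i.

Lemma fps_mulE (R : comUnitRingType) (a b : fps R) (n N : nat) : (n < N)%N ->
  fcoef (fps_mul a b) n = (fps_trunc N a * fps_trunc N b)`_n.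
Proof.
move=> ltnN; rewrite coefM /=; apply: eq_bigr => i _; rewrite !coef_poly.
have leiN : (i < N)%N by apply: leq_ltn_trans ltnN; rewrite -ltnS.
by rewrite leiN (leq_ltn_trans (leq_subr i n) ltnN).
Qed.

Lemma fps_mulC (R : comUnitRingType) : commutative (@fps_mul R).
Proof. by move=> a b; apply: fpsP => n; rewrite !(@fps_mulE _ _ _ n n.+1) // mulrC. Qed.

Lemma fps_mulE3 (R : comUnitRingType) (a b c : fps R) (n : nat) :
  fcoef (fps_mul a (fps_mul b c)) n =
  (fps_trunc n.+1 a * (fps_trunc n.+1 b * fps_trunc n.+1 c))`_n.
Proof.
rewrite coefM.
have -> : fcoef (fps_mul a (fps_mul b c)) n =
    \sum_(i < n.+1) fcoef a i * fcoef (fps_mul b c) (n - i)%N by [].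
apply: eq_bigr => i _.
by rewrite (@fps_mulE _ _ _ _ n.+1) ?ltnS ?leq_subr // coef_poly ltn_ord.
Qed.

Lemma fps_mulA (R : comUnitRingType) : associative (@fps_mul R).
Proof.
move=> a b c; apply: fpsP => n.
by rewrite [in RHS]fps_mulC !fps_mulE3 [in LHS]mulrA [in LHS]mulrC.
Qed.

Lemma fps_mul1 (R : comUnitRingType) : left_id (@fps_one R) (@fps_mul R).
Proof.
move=> a; apply: fpsP => n /=; rewrite big_ord_recl /= mul1r subn0.
by rewrite big1 ?addr0 // => i _; rewrite mul0r.
Qed.

Lemma fps_mulDl (R : comUnitRingType) :
  left_distributive (@fps_mul R) (@fps_add R).
Proof.
move=> a b c; apply: fpsP => n /=; rewrite -big_split /=.
by apply: eq_bigr => i _; rewrite mulrDl.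
Qed.

Lemma fps_one_neq0 (R : comUnitRingType) : @fps_one R != 0.
Proof.
by apply/eqP => /(congr1 (fun a => fcoef a 0%N))/eqP; rewrite /= oner_eq0.
Qed.

HB.instance Definition _ (R : comUnitRingType) :=
  GRing.Zmodule_isComNzRing.Build (fps R)
    (@fps_mulA R) (@fps_mulC R) (@fps_mul1 R) (@fps_mulDl R) (@fps_one_neq0 R).

Definition fps_unit (R : comUnitRingType) : {pred fps R} :=
  [pred a | fcoef a 0%N \is a GRing.unit].

(* The first [n.+1] coefficients of the inverse of [a], computed from
   b_0 = a_0^-1 and b_(n+1) = - a_0^-1 * \sum_(i <= n) a_(n+1-i) * b_i. *)
Fixpoint fps_inv_seq (R : comUnitRingType) (a : fps R) (n : nat) : seq R :=
  if n isn't m.+1 then [:: (fcoef a 0%N)^-1] else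
  let s := fps_inv_seq a m in
  rcons s (- (fcoef a 0%N)^-1 * \sum_(i < m.+1) fcoef a (m.+1 - i)%N * s`_i).

Definition fps_inv (R : comUnitRingType) (a : fps R) : fps R :=
  if a \in @fps_unit R then Fps (fun n => (fps_inv_seq a n)`_n) else a.

Lemma size_fps_inv_seq (R : comUnitRingType) (a : fps R) (n : nat) :
  size (fps_inv_seq a n) = n.+1.
Proof. by elim: n => //= n IHn; rewrite size_rcons IHn. Qed.

Lemma nth_fps_inv_seq (R : comUnitRingType) (a : fps R) (n i : nat) :
  (i <= n)%N -> (fps_inv_seq a n)`_i = (fps_inv_seq a i)`_i.
Proof.
elim: n => [|n IHn]; first by rewrite leqn0 => /eqP->.
rewrite leq_eqVlt => /predU1P[-> //|lein].
by rewrite [in LHS]/= nth_rcons size_fps_inv_seq lein IHn.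
Qed.

Lemma fps_mulV (R : comUnitRingType) :
  {in @fps_unit R, left_inverse 1 (@fps_inv R) *%R}.
Proof.
move=> a ua; rewrite /fps_inv ua; apply: fpsP => -[|n] /=.
  by rewrite big_ord_recl big_ord0 /= addr0 mulVr.
rewrite big_ord_recr /= subnn nth_rcons size_fps_inv_seq ltnn eqxx.
rewrite mulrC mulrA mulrN divrr // mulN1r.
apply/eqP; rewrite subr_eq0; apply/eqP/eq_bigr => i _.
by rewrite mulrC [in RHS]nth_fps_inv_seq // -ltnS.
Qed.

Lemma fps_unitPl (R : comUnitRingType) (a b : fps R) :
  b * a = 1 -> a \in @fps_unit R.
Proof.
move=> /(congr1 (fun c => fcoef c 0%N)) /=; rewrite big_ord_recl big_ord0 addr0.
by move=> ba1; apply/unitrPr; exists (fcoef b 0%N); rewrite mulrC.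
Qed.

Lemma fps_inv_out (R : comUnitRingType) :
  {in [predC @fps_unit R], @fps_inv R =1 id}.
Proof. by move=> a; rewrite inE /= /fps_inv => /negbTE->. Qed.

HB.instance Definition _ (R : comUnitRingType) :=
  GRing.ComNzRing_hasMulInverse.Build (fps R)
    (@fps_mulV R) (@fps_unitPl R) (@fps_inv_out R).

Definition fpsX (R : comUnitRingType) : fps R := Fps (fun n => (n == 1%N)%:R).

(** * q-shifted factorials *)

(* [qpoch a p] is (a; p)_oo = \prod_(t >= 0) (1 - a p^t) for [p] without constant
   term: the factors with [t > n] are then congruent to 1 modulo q^(n+1), so
   they do not affect the coefficient of q^n (see [qpoch_stable]). *)
Definition qpoch (R : comUnitRingType) (a p : fps R) : fps R :=
  Fps (fun n => fcoef (\prod_(t < n.+1) (1 - a * p ^+ t)) n).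

(* (a_1, ..., a_m; p)_oo *)
Definition qpochs (R : comUnitRingType) (s : seq (fps R)) (p : fps R) : fps R :=
  \prod_(a <- s) qpoch a p.

Lemma fcoefB (R : comUnitRingType) (a b : fps R) (n : nat) :
  fcoef (a - b) n = fcoef a n - fcoef b n.
Proof. by []. Qed.

Lemma fcoefM (R : comUnitRingType) (a b : fps R) (n : nat) :
  fcoef (a * b) n = \sum_(i < n.+1) fcoef a i * fcoef b (n - i)%N.
Proof. by []. Qed.

Lemma fcoef_exp_lt (R : comUnitRingType) (p : fps R) (t n : nat) :
  fcoef p 0%N = 0 -> (n < t)%N -> fcoef (p ^+ t) n = 0.
Proof.
move=> p0; elim: t n => // t IHt n ltnt; rewrite exprS fcoefM big1 // => i _.
case: (posnP i) => [->|i_gt0]; first by rewrite p0 mul0r.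
rewrite IHt ?mulr0 //; case: n i ltnt i_gt0 => [|n] i ltnt i_gt0.
  by case: i i_gt0 => -[].
by rewrite -ltnS (leq_trans _ ltnt) // ltnS ltn_subrL i_gt0.
Qed.

Lemma qpoch_stable (R : comUnitRingType) (a p : fps R) (n N : nat) :
  fcoef p 0%N = 0 -> (n < N)%N ->
  fcoef (\prod_(t < N) (1 - a * p ^+ t)) n = fcoef (qpoch a p) n.
Proof.
move=> p0; elim: N => // N IHN; rewrite ltnS leq_eqVlt => /predU1P[-> //|ltnN].
rewrite big_ord_recr [X in fcoef X]mulrBr mulr1 -[RHS]IHN //.
set P := \prod_(i < N) _; rewrite -[RHS]subr0 fcoefB; congr (_ - _).
rewrite mulrA fcoefM big1 // => i _; rewrite fcoef_exp_lt ?mulr0 //.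
exact: leq_ltn_trans (leq_subr _ _) ltnN.
Qed.

Lemma qpoch_unit (R : comUnitRingType) (a p : fps R) :
  fcoef a 0%N = 0 -> qpoch a p \is a GRing.unit.
Proof.
move=> a0; change (fcoef (qpoch a p) 0%N \is a GRing.unit).
by rewrite /= big_ord1 expr0 mulr1 fcoefB a0 subr0 unitr1.
Qed.

(* Main.v *)
Require Import Defs.
From mathcomp Require Import all_boot all_order all_algebra.
From mathcomp Require Import zify ring.

Set Implicit Arguments.
Unset Strict Implicit.
Unset Printing Implicit Defensive.
Import Order.TTheory GRing.Theory Num.Theory.

Local Open Scope ring_scope.

(** Write [t(z) = (q^z, q^(28-z); q^28)_oo].  After clearing denominators the
    identity reads [t(13)^2 t(7)^2 - q^6 t(1)^2 t(7)^2 = t(14)^2 t(6) t(8)], a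
    case of Weierstrass' three-term relation.  By the Jacobi triple product,
    [t(z) (q^28; q^28)_oo = J(z) := \sum_m (-1)^m q^(14m(m-1)+zm)].  The change
    of variables [(m, n) -> (m+n, m-n)] splits a product of two such series: if
    [a, b] (resp. [c, d]) are the sums of [q^(7t^2+4t)] (resp. [q^(7t^2+3t)])
    over even and odd [t], then
      [J(14)J(6) = a^2 - b^2],  [J(14)J(8) = c^2 - d^2],
      [J(13)J(7) = ac - bd],    [q^3 J(7)J(1) = bc - ad],
    and [(ac - bd)^2 - (bc - ad)^2 = (a^2 - b^2)(c^2 - d^2)].  The counting
    statement compares coefficients, [\prod_k (1 - q^k)^-col(k)] being the
    generating function of coloured partitions. *)

(** * Bilateral sums *)

Definition zrange (N : nat) : seq int :=
  [seq i%:Z - N%:Z | i <- index_iota 0 N.*2.+1].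

Lemma mem_zrange N m : (m \in zrange N) = (`|m| <= N%:Z).
Proof.
apply/mapP/idP => [[i]|lemN].
  by rewrite mem_index_iota => lei ->; lia.
exists (absz (m + N%:Z)); last by lia.
by rewrite mem_index_iota; lia.
Qed.

Lemma zrange_uniq N : uniq (zrange N).
Proof. by rewrite map_inj_uniq ?iota_uniq // => i j; lia. Qed.

(** Both sums reduce to their nonzero terms. This is what allows the truncation range of a bilateral
    sum to be changed. *)
Lemma eq_sum_support (I : eqType) (R : zmodType) (r1 r2 : seq I) (F : I -> R) :
    uniq r1 -> uniq r2 -> (forall i, F i != 0 -> (i \in r1) = (i \in r2)) ->
  \sum_(i <- r1) F i = \sum_(i <- r2) F i.
Proof.
move=> u1 u2 r12.
have drop0 r : \sum_(i <- r) F i = \sum_(i <- [seq i <- r | F i != 0]) F i.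
  rewrite big_filter [LHS](bigID (fun i => F i == 0)) /= big1 ?add0r //.
  by move=> i /eqP.
rewrite drop0 [RHS]drop0; apply/perm_big/uniq_perm; rewrite ?filter_uniq //.
move=> i; rewrite !mem_filter; case: eqVneq => //= Fi; exact: r12.
Qed.

(* The series [\sum_m c m q^(e m)] over all integers [m]: when [`|m| <= e m] for
   all [m], the terms outside [zrange n] do not meet the coefficient of [q^n]. *)
Definition bsum (c e : int -> int) : fps int :=
  Fps (fun n => \sum_(m <- zrange n) c m *+ (e m == n%:Z)).

Definition dsum (w E : int * int -> int) : fps int :=
  Fps (fun n => \sum_(p <- [seq (m, k) | m <- zrange n, k <- zrange n])
                  w p *+ (E p == n%:Z)).

Definition coercive (e : int -> int) := forall m, `|m| <= e m.
Definition coercive2 (E : int * int -> int) :=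
  forall p, (`|p.1| <= E p) && (`|p.2| <= E p).

Lemma bsum_coef c e n N : coercive e -> (n <= N)%N ->
  fcoef (bsum c e) n = \sum_(m <- zrange N) c m *+ (e m == n%:Z).
Proof.
move=> pe lenN; apply: eq_sum_support; rewrite ?zrange_uniq // => m.
case: (e m =P n%:Z) => [em _|_]; last by rewrite mulr0n eqxx.
by rewrite !mem_zrange; have := pe m; lia.
Qed.

Lemma square_uniq N : uniq [seq (m, k) | m <- zrange N, k <- zrange N].
Proof. by apply: allpairs_uniq; rewrite ?zrange_uniq // => -[? ?] [? ?]. Qed.

Lemma mem_square N p :
  (p \in [seq (m, k) | m <- zrange N, k <- zrange N])
    = (`|p.1| <= N%:Z) && (`|p.2| <= N%:Z).
Proof.
case: p => m k; rewrite -!mem_zrange.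
apply/allpairsP/andP => [[[a b] [/= ma kb [-> ->]]]|[mN kN]] //.
by exists (m, k).
Qed.

Lemma eq_dsum w w' E E' : w =1 w' -> E =1 E' -> dsum w E = dsum w' E'.
Proof.
by move=> ww EE; apply: fpsP => n /=; apply: eq_bigr => p _; rewrite ww EE.
Qed.

Lemma dsumB w w' E : dsum w E - dsum w' E = dsum (fun p => w p - w' p) E.
Proof.
apply: fpsP => n; rewrite fcoefB /= -sumrB.
by apply: eq_bigr => p _; rewrite mulrnBl.
Qed.

Lemma bsumM c c' e e' : coercive e -> coercive e' ->
  bsum c e * bsum c' e' =
  dsum (fun p => c p.1 * c' p.2) (fun p => e p.1 + e' p.2).
Proof.
move=> pe pe'; apply: fpsP => n; rewrite fcoefM.
transitivity (\sum_(i < n.+1) \sum_(m <- zrange n) \sum_(k <- zrange n)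
    (c m * c' k) *+ ((e m == i%:Z) && (e' k == (n - i)%N%:Z))).
  apply: eq_bigr => i _; rewrite !(@bsum_coef _ _ _ n) ?leq_subr // -1?ltnS //.
  rewrite mulr_suml; apply: eq_bigr => m _; rewrite mulr_sumr.
  by apply: eq_bigr => k _; do 2!case: eqP => _; rewrite ?mulr0 ?mul0r.
rewrite exchange_big [RHS]big_allpairs_dep /=; apply: eq_bigr => m _.
rewrite exchange_big /=; apply: eq_bigr => k _.
have := pe m; have := pe' k => k0 m0.
case: eqP => [emk|Nemk].
  (* In the Cauchy product, a pair [(m, k)] contributes only at the index [i = e m]; by coercivity
     this value is nonnegative, and it is at most [n] if the pair contributes at all. *)
  have lt : (absz (e m) < n.+1)%N by lia.
  rewrite (bigD1 (Ordinal lt)) //= big1 ?addr0 => [|i].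
    by have -> : (e m == absz (e m)) && (e' k == (n - absz (e m))%N) by lia.
  rewrite -val_eqE /= => ne.
  by have -> : (e m == i) && (e' k == (n - i)%N) = false by lia.
rewrite big1 // => i _.
have lti := ltn_ord i.
by have -> : (e m == i) && (e' k == (n - i)%N) = false by lia.
Qed.

(** Injectivity of [f] is enough, since [w] vanishes off its image: the maps used below reach only
    the pairs of equal, or of opposite, parity. Coercivity before and after the substitution ensures
    that neither truncation loses a term. *)
Lemma dsum_reindex (f g : int * int -> int * int) w E :
    cancel f g -> coercive2 E -> coercive2 (E \o f) ->
    (forall p, w p != 0 -> f (g p) = p) ->
  dsum w E = dsum (w \o f) (E \o f).
Proof.
move=> fK pE pEf gK; apply: fpsP => n /=.
rewrite -[RHS](big_map f predT (fun p => w p *+ (E p == n%:Z))).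
apply: eq_sum_support; rewrite ?(map_inj_uniq (can_inj fK)) ?square_uniq //.
move=> p.
case: (E p =P n%:Z) => [Ep|_]; last by rewrite mulr0n eqxx.
rewrite mulr1n => /gK fgp; rewrite -fgp (mem_map (can_inj fK)) fgp !mem_square.
have /andP[] := pE p; have := pEf (g p); rewrite /= fgp => /andP[].
by rewrite Ep => -> -> -> ->.
Qed.

Lemma fcoefXnM (n i : nat) (a : fps int) :
  fcoef (fpsX int ^+ n * a) i = if (i < n)%N then 0 else fcoef a (i - n)%N.
Proof.
elim: n i => [|n IHn] i; first by rewrite mul1r subn0.
rewrite exprS -mulrA; set b := _ * a in IHn *.
rewrite fcoefM; case: i => [|i]; first by rewrite big_ord1 mul0r.
rewrite big_ord_recl mul0r add0r big_ord_recl mul1r big1 => [|j _].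
  by rewrite addr0 subn1 IHn ltnS subSS.
by rewrite mul0r.
Qed.

Lemma dsumXn (n : nat) w E : coercive2 E ->
  fpsX int ^+ n * dsum w E = dsum w (fun p => E p + n%:Z).
Proof.
move=> pE; apply: fpsP => i; rewrite fcoefXnM; case: ltnP => [lt|le] /=.
  rewrite big1 // => p _; have := pE p => pEp.
  by have -> : (E p + n == i%:Z) = false by lia.
rewrite [RHS](eq_bigr (fun p => w p *+ (E p == (i - n)%N%:Z))); last first.
  by move=> p _; congr (_ *+ nat_of_bool _); lia.
apply: eq_sum_support; rewrite ?square_uniq // => p.
case: (E p =P (i - n)%N%:Z) => [Ep _|_]; last by rewrite mulr0n eqxx.
rewrite !mem_square; have /andP[] := pE p; move: Ep; move: (E p) => v.
case: p => m k /= -> p1 p2.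
by lia.
Qed.

(** * Products of two theta series *)

Definition zsign (m : int) : int := (-1) ^+ absz m.

(** Parity is a coefficient rather than a substitution [m = 2t], so that both halves keep the same
    exponent and [dsumB] can combine their products. *)
Definition zpar (b : bool) (m : int) : int := (odd (absz m) == b)%:R.

Definition theta_exp (h z m : int) : int := h * (m * (m - 1)) + z * m.
Definition square_exp (g x m : int) : int := g * m ^+ 2 + x * m.

(** For positive [m], use [h m (m-1) >= 0] and [z >= 1]. For negative [m], rewrite the exponent as
    [h m (m+1) + (2h - z)(-m)] and use [2h - z >= 1]. *)
Lemma theta_exp_coercive h z : 0 < z < h *+ 2 -> coercive (theta_exp h z).
Proof.
rewrite mulr2n => /andP[z_gt0 z_lt] m; rewrite /theta_exp.
case: (ltrP 0 m) => m0.
  have : 0 <= h * (m * (m - 1)) by rewrite !mulr_ge0 //; lia.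
  have : 0 <= (z - 1) * m by rewrite mulr_ge0 //; lia.
  by lia.
case: (eqVneq m 0) => [->|mN0]; first by lia.
have : 0 <= h * (m * (m + 1)).
  by rewrite mulr_ge0 //; [lia | rewrite mulr_le0 //; lia].
have : 0 <= (h + h - z - 1) * - m by rewrite mulr_ge0 //; lia.
by lia.
Qed.

Lemma square_exp_coercive g x : `|x| < g -> coercive (square_exp g x).
Proof.
move=> x_lt m; rewrite /square_exp expr2; case: (ltrP 0 m) => m0.
  have : 0 <= g * (m * (m - 1)) by rewrite !mulr_ge0 //; lia.
  have : 0 <= (g + x - 1) * m by rewrite mulr_ge0 //; lia.
  by lia.
case: (eqVneq m 0) => [->|mN0]; first by lia.
have : 0 <= g * (m * (m + 1)).
  by rewrite mulr_ge0 //; [lia | rewrite mulr_le0 //; lia].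
have : 0 <= (g - x - 1) * - m by rewrite mulr_ge0 //; lia.
by lia.
Qed.

Definition jtheta (h z : int) : fps int := bsum zsign (theta_exp h z).
Definition half_theta (b : bool) (g x : int) : fps int :=
  bsum (zpar b) (square_exp g x).

Lemma zsignD m n : zsign m * zsign n = if odd (absz (m + n)) then -1 else 1.
Proof.
rewrite /zsign -exprD -signr_odd.
have -> : odd (absz m + absz n) = odd (absz (m + n)) by lia.
by case: (odd _); rewrite ?expr1 ?expr0.
Qed.

(** With [s = -(m+n)] and [t = m-n], the exponents add up to [g s^2 + x s + g t^2 + y t]. Here [s]
    and [t] have equal parity, and the sign [(-1)^(m+n)] is positive exactly when both are even. *)
Lemma jthetaM_even (h g x y z1 z2 : int) :
    h = g *+ 2 -> z1 = h - x + y -> z2 = h - x - y -> `|x| < g -> `|y| < g ->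
  jtheta h z1 * jtheta h z2
  = half_theta false g x * half_theta false g y
    - half_theta true g x * half_theta true g y.
Proof.
move=> -> -> -> xg yg.
have px := square_exp_coercive xg; have py := square_exp_coercive yg.
have p1 : coercive (theta_exp (g *+ 2) (g *+ 2 - x + y)).
  by apply: theta_exp_coercive; lia.
have p2 : coercive (theta_exp (g *+ 2) (g *+ 2 - x - y)).
  by apply: theta_exp_coercive; lia.
rewrite /jtheta /half_theta !bsumM // dsumB.
rewrite [RHS](dsum_reindex (f := fun p => (- (p.1 + p.2), p.1 - p.2))
  (g := fun p => ((p.2 - p.1) %/ 2, - (p.1 + p.2) %/ 2)%Z)).
- apply: eq_dsum => -[m n] /=; last by rewrite /theta_exp /square_exp; ring.
  rewrite zsignD /zpar.
  have -> : odd (absz (- (m + n))) = odd (absz (m + n)) by lia.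
  have -> : odd (absz (m - n)) = odd (absz (m + n)) by lia.
  by case: odd.
- by move=> [m n] /=; congr (_, _); lia.
- by move=> [m n] /=; have := px m; have := py n; lia.
- move=> [m n] /=; 
  have -> : square_exp g x (- (m + n)) + square_exp g y (m - n)
      = theta_exp (g *+ 2) (g *+ 2 - x + y) m
        + theta_exp (g *+ 2) (g *+ 2 - x - y) n.
    by rewrite /theta_exp /square_exp; ring.
  by have := p1 m; have := p2 n; lia.
- move=> [m n] /=; rewrite /zpar => w0.
  have par : odd (absz m) = odd (absz n) by move: w0; do 2!case: odd.
  by congr (_, _); lia.
Qed.

(** Here [s = m+n-1] and [t = m-n] have opposite parity, the sign being positive when [s] is odd.
    Completing the square in [s] leaves the constant [g - x = k], which the factor [q^k]
    supplies. *)
Lemma jthetaM_odd (k : nat) (h g x y z1 z2 : int) :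
    h = g *+ 2 -> z1 = x + y -> z2 = x - y -> x + k%:Z = g ->
    `|x| < g -> `|y| < x ->
  fpsX int ^+ k * (jtheta h z1 * jtheta h z2)
  = half_theta true g x * half_theta false g y
    - half_theta false g x * half_theta true g y.
Proof.
move=> -> -> -> xk xg xy; have yg : `|y| < g by lia.
have px := square_exp_coercive xg; have py := square_exp_coercive yg.
have p1 : coercive (theta_exp (g *+ 2) (x + y)).
  by apply: theta_exp_coercive; lia.
have p2 : coercive (theta_exp (g *+ 2) (x - y)).
  by apply: theta_exp_coercive; lia.
rewrite /jtheta /half_theta !bsumM // dsumB dsumXn; last first.
  by move=> [m n] /=; have := p1 m; have := p2 n; lia.
rewrite [RHS](dsum_reindex (f := fun p => (p.1 + p.2 - 1, p.1 - p.2))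
  (g := fun p => ((p.2 + p.1 + 1) %/ 2, (p.1 - p.2 + 1) %/ 2)%Z)).
- apply: eq_dsum => -[m n] /=; last first.
    by rewrite /theta_exp /square_exp -xk; ring.
  rewrite zsignD /zpar.
  have -> : odd (absz (m + n - 1)%R) = ~~ odd (absz (m + n)) by lia.
  have -> : odd (absz (m - n)) = odd (absz (m + n)) by lia.
  by case: odd.
- by move=> [m n] /=; congr (_, _); lia.
- by move=> [m n] /=; have := px m; have := py n; lia.
- move=> [m n] /=.
  have -> : square_exp g x (m + n - 1) + square_exp g y (m - n)
      = theta_exp (g *+ 2) (x + y) m + theta_exp (g *+ 2) (x - y) n + k%:Z.
    by rewrite /theta_exp /square_exp -xk; ring.
  by have := p1 m; have := p2 n; lia.
- move=> [m n] /=; rewrite /zpar => w0.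
  have par : odd (absz m) = ~~ odd (absz n) by move: w0; do 2!case: odd.
  by congr (_, _); lia.
Qed.

(** * The Jacobi triple product *)

Section GaussianBinomials.

Variables (R : comNzRingType) (Q : R).

(** Gaussian binomials by the q-Pascal rule, since a general ring has no quotients of q-factorials.
    The truncation of [n' - k'] is harmless: [qbin n' k'] is 0 when [k' > n']. *)
Fixpoint qbin (n k : nat) : R :=
  match n, k with
  | _, 0 => 1
  | 0, _.+1 => 0
  | n'.+1, k'.+1 => Q ^+ (n' - k') * qbin n' k' + qbin n' k'.+1
  end.

Definition qfact (n : nat) : R := \prod_(i < n) (1 - Q * Q ^+ i).

Lemma qbinn0 n : qbin n 0 = 1. Proof. by case: n. Qed.

Lemma qbin_small n k : (n < k)%N -> qbin n k = 0.
Proof.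
elim: n k => [|n IHn] [|k] //= ltnk.
by rewrite !IHn ?mulr0 ?addr0 // ltnW.
Qed.

Lemma qbinomial (x y : R) n :
  \prod_(i < n) (y + x * Q ^+ i) =
  \sum_(k < n.+1) qbin n k * Q ^+ 'C(k, 2) * x ^+ k * y ^+ (n - k).
Proof.
elim: n => [|n IHn].
  by rewrite big_ord0 big_ord1 /= !mulr1.
rewrite big_ord_recr IHn /= mulrDr [RHS]big_ord_recl /= [LHS]addrC.
set S := \sum_(k < n.+1) _.
have -> : \sum_(i < n.+1) qbin n.+1 (bump 0 i) * Q ^+ 'C(bump 0 i, 2)
      * x ^+ bump 0 i * y ^+ (n.+1 - bump 0 i)
  = S * (x * Q ^+ n) + \sum_(i < n.+1) qbin n i.+1 * Q ^+ 'C(i.+1, 2)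
      * x ^+ i.+1 * y ^+ (n - i).
  rewrite mulr_suml -big_split /=; apply: eq_bigr => i _.
  rewrite /bump leq0n add1n subSS.
  have -> : Q ^+ n = Q ^+ (n - i) * Q ^+ i by rewrite -exprD subnK // -ltnS.
  by rewrite /= binS bin1 !exprD exprS; ring.
rewrite addrCA; congr (_ + _).
rewrite big_ord_recr /= qbin_small // !mul0r addr0 /S big_ord_recl mulrDl.
rewrite qbinn0 /= !mulr1 !mul1r subn0 -exprSr; congr (_ + _).
rewrite mulr_suml; apply: eq_bigr => i _.
by rewrite /bump leq0n add1n -mulrA -exprSr subnSK.
Qed.

Lemma qfactS n : qfact n.+1 = qfact n * (1 - Q ^+ n.+1).
Proof. by rewrite /qfact big_ord_recr /= -exprS. Qed.

(** The two terms of the Pascal rule contribute [Q^(n-k) (1 - Q^(k+1))] and [1 - Q^(n-k)] times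
    [qfact n], with sum [(1 - Q^(n+1)) qfact n]. *)
Lemma qbin_fact n k : (k <= n)%N ->
  qbin n k * (qfact k * qfact (n - k)) = qfact n.
Proof.
have qfact0 : qfact 0 = 1 by rewrite /qfact big_ord0.
elim: n k => [|n IHn] [|k] //= lekn.
- by rewrite qfact0 !mulr1.
- by rewrite qfact0 subn0 !mul1r.
rewrite subSS mulrDl; have := IHn _ lekn; rewrite qfactS => IHk.
have -> : Q ^+ (n - k) * qbin n k * (qfact k * (1 - Q ^+ k.+1) * qfact (n - k))
    = Q ^+ (n - k) * (1 - Q ^+ k.+1) * qfact n by rewrite -IHk; ring.
have [ltkn|lenk] := ltnP k n; last first.
  have -> : k = n by apply/eqP; rewrite eqn_leq lenk andbT.
  by rewrite qbin_small // subnn qfactS; ring.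
have := IHn _ ltkn; rewrite qfactS => IHk1.
have -> : qfact (n - k) = qfact (n - k.+1) * (1 - Q ^+ (n - k)).
  by rewrite -(@subnSK k n) // qfactS.
have -> : qbin n k.+1 * (qfact k * (1 - Q ^+ k.+1)
      * (qfact (n - k.+1) * (1 - Q ^+ (n - k)))) = (1 - Q ^+ (n - k)) * qfact n.
  by rewrite -IHk1; ring.
have -> : qfact n.+1 = qfact n * (1 - Q ^+ (n - k) * Q ^+ k.+1).
  by rewrite qfactS -exprD addnS subnK // ltnW.
by ring.
Qed.

(** The q-binomial theorem for [2N] factors with [x = -z] and [y = Q^N]. The upper half gives
    [Q^N (1 - z Q^i)]; in the lower half [Q = z w] lets [-z Q^i] be factored out, leaving
    [1 - w Q^(N-1-i)]. No inverse of [z] is needed. *)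
Lemma finite_triple_product (z w : R) N : z * w = Q ->
  (- z) ^+ N * Q ^+ 'C(N, 2) * (Q ^+ N) ^+ N
    * (\prod_(i < N) (1 - z * Q ^+ i) * \prod_(i < N) (1 - w * Q ^+ i))
  = \sum_(k < (N + N).+1) qbin (N + N) k * Q ^+ 'C(k, 2) * (- z) ^+ k
      * (Q ^+ N) ^+ (N + N - k).
Proof.
move=> zw; rewrite -qbinomial big_split_ord /=.
have -> : \prod_(i < N) (Q ^+ N + - z * Q ^+ i)
    = (- z) ^+ N * Q ^+ 'C(N, 2) * \prod_(i < N) (1 - w * Q ^+ i).
  rewrite [X in _ * X](reindex_inj rev_ord_inj) /= -[N in (- z) ^+ N]card_ord.
  rewrite -bin2_sum big_mkord expr_sum -prodr_const -!big_split /=.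
  apply: eq_bigr => i _.
  have -> : Q ^+ N = Q ^+ (N - i.+1) * (z * w * Q ^+ i).
    by rewrite zw -exprS -exprD subnK.
  by ring.
have -> : \prod_(i < N) (Q ^+ N + - z * Q ^+ (N + i))
    = (Q ^+ N) ^+ N * \prod_(i < N) (1 - z * Q ^+ i).
  rewrite -[in RHS](card_ord N) -prodr_const card_ord -big_split /=.
  by apply: eq_bigr => i _; rewrite exprD; ring.
by ring.
Qed.

End GaussianBinomials.

Local Notation q := (fpsX int).

(** * Congruence of power series modulo [q^(n+1)] *)

Definition eqmod (n : nat) (a b : fps int) :=
  forall i, (i <= n)%N -> fcoef a i = fcoef b i.

Lemma eqmodM n a b c d : eqmod n a b -> eqmod n c d -> eqmod n (a * c) (b * d).
Proof.
move=> ab cd i lein; rewrite !fcoefM; apply: eq_bigr => j _.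
rewrite ab ?cd // ?(leq_trans (leq_subr _ _)) //.
by apply: leq_trans lein; rewrite -ltnS.
Qed.

Lemma eqmod_trans n a b c : eqmod n a b -> eqmod n b c -> eqmod n a c.
Proof. by move=> ab bc i lein; rewrite ab ?bc. Qed.

Lemma eqmod_sym n a b : eqmod n a b -> eqmod n b a.
Proof. by move=> ab i /ab. Qed.

Lemma eqmod_prod n (I : Type) (r : seq I) (P : pred I) (F G : I -> fps int) :
    (forall i, P i -> eqmod n (F i) (G i)) ->
  eqmod n (\prod_(i <- r | P i) F i) (\prod_(i <- r | P i) G i).
Proof.
move=> FG; apply: (big_ind2 (eqmod n)) => //.
by move=> *; apply: eqmodM.
Qed.

Lemma eqmod_prod1 n (I : Type) (r : seq I) (P : pred I) (F : I -> fps int) :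
    (forall i, P i -> eqmod n (F i) 1) -> eqmod n (\prod_(i <- r | P i) F i) 1.
Proof.
move=> F1; apply: (big_ind (fun a => eqmod n a 1)) => //.
by move=> a b a1 b1; rewrite -[1]mulr1; apply: eqmodM.
Qed.

Lemma eqmod_mulIr n (u a b : fps int) :
  u \is a GRing.unit -> eqmod n (a * u) (b * u) -> eqmod n a b.
Proof.
move=> uu ab; rewrite -(mulrK uu a) -(mulrK uu b).
by apply: eqmodM.
Qed.

Lemma eqmodV n (a b : fps int) :
  a \is a GRing.unit -> b \is a GRing.unit -> eqmod n a b -> eqmod n a^-1 b^-1.
Proof.
move=> ua ub ab; apply: (eqmod_mulIr ub); rewrite mulVr //.
by rewrite -(mulVr ua); apply: eqmodM => //; apply: eqmod_sym.
Qed.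

Lemma fcoef_sum (I : Type) (r : seq I) (P : pred I) (F : I -> fps int) n :
  fcoef (\sum_(i <- r | P i) F i) n = \sum_(i <- r | P i) fcoef (F i) n.
Proof. exact: (big_morph (fun a : fps int => fcoef a n)). Qed.

Lemma fcoefXn m n : fcoef (q ^+ m) n = (n == m)%:R.
Proof.
rewrite -[q ^+ m]mulr1 fcoefXnM; case: ltnP => [ltnm|lemn].
  by rewrite ltn_eqF.
by congr (nat_of_bool _)%:R; rewrite subn_eq0 eqn_leq lemn andbT.
Qed.

Lemma mulXnI m : injective (fun a : fps int => q ^+ m * a).
Proof.
move=> a b ab; apply: fpsP => n.
have : fcoef (q ^+ m * a) (n + m) = fcoef (q ^+ m * b) (n + m) by congr fcoef.
by rewrite !fcoefXnM ltnNge leq_addl addnK.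
Qed.

Lemma qpoch_eqmod (a p : fps int) n N : fcoef p 0%N = 0 -> (n < N)%N ->
  eqmod n (\prod_(t < N) (1 - a * p ^+ t)) (qpoch a p).
Proof.
by move=> p0 ltnN i lein; apply: qpoch_stable => //; apply: leq_ltn_trans ltnN.
Qed.

(* Multiplying by [(p; p)_oo] turns the Gaussian binomials of the finite triple
   product into series congruent to 1. *)
Lemma qbin_eqmod (p : fps int) n m k : fcoef p 0%N = 0 ->
  (n < k)%N -> (n + k < m)%N -> eqmod n (qbin p m k * qpoch p p) 1.
Proof.
move=> p0 ltnk ltkm; have upp := qpoch_unit p p0.
apply: (eqmod_mulIr upp); rewrite mul1r -mulrA.
have fact_pp j : (n < j)%N -> eqmod n (qfact p j) (qpoch p p).
  by move=> ltnj; apply: qpoch_eqmod.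
apply: (@eqmod_trans _ _ (qbin p m k * (qfact p k * qfact p (m - k)))).
  by apply: eqmodM => //; apply/eqmod_sym/eqmodM; apply: fact_pp => //; lia.
by rewrite qbin_fact; [apply: fact_pp | ]; lia.
Qed.

(** Matches the powers of [q] in the finite triple product with base [q^(2h)]: once the common
    prefactor is removed, term [k] carries the theta exponent at [k - N]. *)
Lemma theta_exp_shift (h z N k : nat) : (0 < z < h.*2)%N -> (k <= N + N)%N ->
  (z * N + h.*2 * 'C(N, 2) + h.*2 * (N * N)
     + absz (theta_exp h z (k%:Z - N%:Z))
   = h.*2 * 'C(k, 2) + z * k + h.*2 * (N * (N + N - k)))%N.
Proof.
move=> z_bd lek; apply/eqP; rewrite -eqz_nat; apply/eqP.
have bin2E m : (h.*2 * 'C(m, 2))%N%:Z = h%:Z * (m%:Z * (m%:Z - 1)).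
  rewrite -muln2 -mulnA -[in LHS]mul_bin_diag bin1.
  by rewrite !PoszM; case: m => [|m]; [lia | congr (_ * (_ * _)); lia].
have abs_theta : (absz (theta_exp h z (k%:Z - N%:Z)))%:Z
    = theta_exp h z (k%:Z - N%:Z).
  have := @theta_exp_coercive h z _ (k%:Z - N%:Z).
  by move=> th; apply: gez0_abs; apply: le_trans (normr_ge0 _) (th _); lia.
rewrite !PoszD abs_theta !bin2E !PoszM -subzn // PoszD -muln2 PoszM /theta_exp.
by ring.
Qed.

Lemma finite_jtheta (h z N : nat) : (0 < z < h.*2)%N ->
  \prod_(i < N) (1 - q ^+ z * (q ^+ h.*2) ^+ i)
    * \prod_(i < N) (1 - q ^+ (h.*2 - z) * (q ^+ h.*2) ^+ i)
  = \sum_(k < (N + N).+1) (-1) ^+ (N + k)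
      * q ^+ absz (theta_exp h z (k%:Z - N%:Z)) * qbin (q ^+ h.*2) (N + N) k.
Proof.
move=> /andP[z_gt0 z_lt].
have zw : q ^+ z * q ^+ (h.*2 - z) = q ^+ h.*2 by rewrite -exprD subnKC // ltnW.
have finP := finite_triple_product N zw.
(* The prefactor of [finite_triple_product] is this power of [q] times [(-1)^N]; both can be
   cancelled. *)
apply: (@mulXnI (z * N + h.*2 * 'C(N, 2) + h.*2 * (N * N))) => /=.
apply: (can_inj (signrMK N)); rewrite mulrA.
have -> : (-1) ^+ N * q ^+ (z * N + h.*2 * 'C(N, 2) + h.*2 * (N * N))
    = (- q ^+ z) ^+ N * (q ^+ h.*2) ^+ 'C(N, 2) * ((q ^+ h.*2) ^+ N) ^+ N.
  by rewrite [(- q ^+ z) ^+ N]exprNn -!exprM !exprD !mulrA.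
rewrite finP !mulr_sumr; apply: eq_bigr => k _.
rewrite [(- q ^+ z) ^+ k]exprNn -!exprM.
have -> : (-1) ^+ N * (q ^+ (z * N + h.*2 * 'C(N, 2) + h.*2 * (N * N))
    * ((-1) ^+ (N + k) * q ^+ absz (theta_exp h z (k%:Z - N%:Z))
       * qbin (q ^+ h.*2) (N + N) k))
  = (-1) ^+ (N + (N + k)) * qbin (q ^+ h.*2) (N + N) k
    * q ^+ (z * N + h.*2 * 'C(N, 2) + h.*2 * (N * N)
            + absz (theta_exp h z (k%:Z - N%:Z))).
  by rewrite [q ^+ (_ + absz _)]exprD [(-1) ^+ (N + (N + k))]exprD; ring.
have -> : (-1) ^+ (N + (N + k)) = (-1) ^+ k :> fps int.
  by rewrite -signr_odd !oddD addbA addbb signr_odd.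
rewrite theta_exp_shift ?z_gt0 //; last by rewrite -ltnS.
by rewrite !exprD; move: ((-1) ^+ k) => s; ring.
Qed.

Theorem jacobi_triple_product (h z : nat) : (0 < z < h.*2)%N ->
  jtheta h z = qpoch (q ^+ z) (q ^+ h.*2) * qpoch (q ^+ (h.*2 - z)) (q ^+ h.*2)
               * qpoch (q ^+ h.*2) (q ^+ h.*2).
Proof.
move=> z_bd; have pe : coercive (theta_exp h z).
  by apply: theta_exp_coercive; lia.
have Q0 : fcoef (q ^+ h.*2) 0%N = 0.
  by rewrite fcoefXn ltn_eqF //; lia.
(* A term reaching degree [n] has [|k - N| <= n]. So [N > 2n] gives [n < k] and [n + k < 2N], the
   conditions of [qbin_eqmod]. *)
apply: fpsP => n; have [N leN] : exists N, (n.*2 < N)%N by exists n.*2.+1.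
transitivity (fcoef (\prod_(i < N) (1 - q ^+ z * (q ^+ h.*2) ^+ i)
    * \prod_(i < N) (1 - q ^+ (h.*2 - z) * (q ^+ h.*2) ^+ i)
    * qpoch (q ^+ h.*2) (q ^+ h.*2)) n); last first.
  have ltnN : (n < N)%N by lia.
  apply: (@eqmodM n) => //.
  by apply: (@eqmodM n); apply: qpoch_eqmod.
rewrite finite_jtheta // mulr_suml fcoef_sum.
rewrite (@bsum_coef _ _ _ N) //; last by lia.
rewrite addnn big_map big_mkord; apply: eq_bigr => k _.
have -> : zsign (k%:Z - N%:Z) = (-1) ^+ (N + k).
  by rewrite /zsign -signr_odd -[RHS]signr_odd; congr (_ ^+ nat_of_bool _); lia.
set e := absz _; have e_pos := pe (k%:Z - N%:Z).
have fsign (a : fps int) j : fcoef ((-1) ^+ j * a) n = (-1) ^+ j * fcoef a n.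
  rewrite -signr_odd -[in RHS]signr_odd.
  by case: (odd j); rewrite ?expr1 ?expr0 ?mulN1r ?mul1r.
rewrite -!mulrA fsign fcoefXnM; case: ltnP => [ltne|leen].
  by rewrite mulr0; have -> : (theta_exp h z (k%:Z - N%:Z) == n) = false by lia.
rewrite (@qbin_eqmod _ n) ?leq_subr //; try lia.
by rewrite -mulr_natr; congr (_ * (nat_of_bool _)%:R); lia.
Qed.

(** * Generating functions of coloured partitions *)

Lemma eqmod1BXn n m : (n < m)%N -> eqmod n (1 - q ^+ m) 1.
Proof.
move=> ltnm i lein; rewrite fcoefB fcoefXn ltn_eqF ?subr0 //.
exact: leq_ltn_trans ltnm.
Qed.

Lemma unit1BXn m : (0 < m)%N -> 1 - q ^+ m \is a GRing.unit.
Proof.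
move=> m_gt0; change (fcoef (1 - q ^+ m) 0 \is a GRing.unit).
by rewrite (@eqmod1BXn 0).
Qed.

(** Modulo [q^(n+1)] each factor is inverted by a geometric sum of [n+1] terms. Expanding the
    product of these sums over all coloured parts indexes the monomials by the multiplicity
    functions [f]. *)
Lemma coloured_partitions_gf col n :
  (#|coloured_partitions col n|)%:Z =
  fcoef (\prod_(i < n) (1 - q ^+ i.+1) ^+ col i.+1)^-1 n.
Proof.
pose geom k : fps int := \sum_(j < n.+1) q ^+ (j * k).
have geomM k : (0 < k)%N -> eqmod n (geom k * (1 - q ^+ k)) 1.
  move=> k_gt0.
  have -> : geom k * (1 - q ^+ k) = 1 - q ^+ (k * n.+1).
    rewrite exprM -[1 in RHS](expr1n _ n.+1) subrXX mulrC; congr (_ * _).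
    apply: eq_bigr => j _.
    by rewrite expr1n mul1r -exprM mulnC.
  by apply: eqmod1BXn; rewrite leq_pmull.
have -> : \prod_(i < n) (1 - q ^+ i.+1) ^+ col i.+1
    = \prod_(x : coloured_part col n) (1 - q ^+ (tag x).+1).
  rewrite -(sig_big_dep xpredT (fun _ _ => true)
    (fun (i : 'I_n) (c : 'I_(col i.+1)) => 1 - q ^+ i.+1)) /=.
  by apply: eq_bigr => i _; rewrite prodr_const card_ord.
set P := \prod_x _.
have uP : P \is a GRing.unit.
  by apply: rpred_prod => x _; apply: unit1BXn.
have geomP : eqmod n (\prod_(x : coloured_part col n) geom (tag x).+1) P^-1.
  apply: (eqmod_mulIr uP); rewrite mulVr // -big_split /=.
  by apply: eqmod_prod1 => x _; apply: geomM.
rewrite -geomP // bigA_distr_bigA fcoef_sum -sum1_card -natz natr_sum.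
rewrite [RHS](bigID (mem (coloured_partitions col n))) /= [X in _ + X]big1.
  rewrite addr0; apply: eq_bigr => f; rewrite inE => /eqP fn.
  by rewrite -expr_sum fn fcoefXn eqxx.
move=> f; rewrite inE => fn.
by rewrite -expr_sum fcoefXn eq_sym (negbTE fn).
Qed.

(** By induction on blocks of [M] consecutive integers, each containing a single member of the
    residue class. *)
Lemma prod_residue_class (M s N : nat) : (s < M)%N ->
  \prod_(t < N) (1 - q ^+ s * (q ^+ M) ^+ t)
  = \prod_(0 <= i < N * M) (1 - q ^+ i) ^+ (i %% M == s)%N.
Proof.
move=> ltsM; elim: N => [|N IHN]; first by rewrite big_ord0 big_geq.
rewrite big_ord_recr IHN /= [RHS](big_cat_nat _ (n := N * M)) //=; last first.
  by rewrite leq_mul2r leqnSn orbT.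
congr (_ * _); rewrite -{1}[(N * M)%N]add0n big_addn mulSn addnK big_mkord.
rewrite (bigD1 (Ordinal ltsM)) //= big1 ?mulr1 => [|i neis].
  by rewrite addnC modnMDl modn_small // eqxx expr1 -exprM -exprD mulnC addnC.
rewrite addnC modnMDl modn_small //.
by move: neis; rewrite -val_eqE /= => /negbTE->; rewrite expr0.
Qed.

Lemma prod_qpoch_eqmod (M : nat) (l : seq nat) (n : nat) :
    all (fun s => 0 < s < M)%N l ->
  eqmod n (\prod_(s <- l) qpoch (q ^+ s) (q ^+ M))
          (\prod_(i < n) (1 - q ^+ i.+1) ^+ count_mem (i.+1 %% M)%N l).
Proof.
(* The empty list is treated apart because only a member of [l] forces [M > 0]. *)
move=> /allP l_bd; case: l l_bd => [|s0 l'] l_bd.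
  rewrite big_nil big1 // => i _; exact: expr0.
move: (s0 :: l') (mem_head s0 l') l_bd => l s0l l_bd.
have M_gt0 : (0 < M)%N by have := l_bd _ s0l; lia.
have Q0 : fcoef (q ^+ M) 0%N = 0 by rewrite fcoefXn ltn_eqF.
pose F i : fps int := (1 - q ^+ i) ^+ count_mem (i %% M)%N l.
have prodF N : \prod_(s <- l) \prod_(t < N) (1 - q ^+ s * (q ^+ M) ^+ t)
    = \prod_(0 <= i < N * M) F i.
  rewrite big_seq (eq_bigr (fun s => \prod_(0 <= i < N * M)
    (1 - q ^+ i) ^+ (i %% M == s)%N)) => [|s sl]; last first.
    by apply: prod_residue_class; have := l_bd _ sl; lia.
  rewrite -big_seq exchange_big /=; apply: eq_bigr => i _.
  rewrite /F -expr_sum -sum1_count [in RHS]big_mkcond /=; congr (_ ^+ _).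
    by apply: eq_bigr => s _; rewrite eq_sym; case: eqP.
(* As [1 - q^0 = 0], this relies on 0 not being a residue in [l]. *)
have F0 : F 0%N = 1.
  rewrite /F mod0n (_ : count_mem _ _ = 0%N) //; apply/count_memPn/negP.
  by move=> /l_bd; rewrite ltnn.
have -> : \prod_(i < n) (1 - q ^+ i.+1) ^+ count_mem (i.+1 %% M)%N l
    = \prod_(0 <= i < n.+1) F i.
  by rewrite big_nat_recl // F0 mul1r big_mkord.
apply: (@eqmod_trans _ _ (\prod_(0 <= i < n.+1 * M) F i)).
  rewrite -prodF; apply: eqmod_prod => s _.
  by apply: eqmod_sym; apply: qpoch_eqmod.
rewrite (big_cat_nat _ (n := n.+1)) //=; last by rewrite leq_pmulr.
rewrite -[X in eqmod n _ X]mulr1; apply: eqmodM => //.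
rewrite big_nat; apply: eqmod_prod1 => i /andP[ltni _].
rewrite /F -[count_mem _ _]card_ord -prodr_const.
by apply: eqmod_prod1 => j _; apply: eqmod1BXn.
Qed.

Lemma residue_coloured_partitions_gf (M : nat) (l : seq nat) col n :
    all (fun s => 0 < s < M)%N l ->
    (forall k, col k = count_mem (k %% M)%N l) ->
  (#|coloured_partitions col n|)%:Z =
  fcoef (\prod_(s <- l) qpoch (q ^+ s) (q ^+ M))^-1 n.
Proof.
move=> l_bd colE; rewrite coloured_partitions_gf.
have -> : \prod_(i < n) (1 - q ^+ i.+1) ^+ col i.+1
    = \prod_(i < n) (1 - q ^+ i.+1) ^+ count_mem (i.+1 %% M)%N l.
  by apply: eq_bigr => i _; rewrite colE.
apply: (@eqmodV n) => //; last exact/eqmod_sym/prod_qpoch_eqmod.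
  by apply: rpred_prod => i _; apply/rpredX/unit1BXn.
rewrite big_seq; apply: rpred_prod => s /(allP l_bd)/andP[s_gt0 _].
by apply: qpoch_unit; rewrite fcoefXn ltn_eqF.
Qed.

(** * The modulus 28 *)

(** At [z = 14] the two factors coincide, so [theta28 14 ^+ 2] is the fourth power of
    [(q^14; q^28)_oo], whence the four colours. *)
Definition theta28 (z : nat) : fps int :=
  qpoch (q ^+ z) (q ^+ 28) * qpoch (q ^+ (28 - z)) (q ^+ 28).

Lemma theta28_relation :
  (theta28 13 * theta28 7) ^+ 2 - q ^+ 6 * (theta28 7 * theta28 1) ^+ 2
  = theta28 14 ^+ 2 * theta28 6 * theta28 8.
Proof.
pose u := qpoch (q ^+ 28) (q ^+ 28).
have uu : u \is a GRing.unit by apply: qpoch_unit; rewrite fcoefXn.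
have jt (z : nat) : (0 < z < 28)%N -> jtheta 14%:Z z%:Z = theta28 z * u.
  by move=> zb; apply: (@jacobi_triple_product 14).
(* The series [a, b, c, d] of the overview are [a false], [a true], [c false], [c true]. The pair
   [(x, y)] is [(4, 4)] in [e1], [(3, 3)] in [e2] and [(4, 3)] in [e3] and [e4]. *)
pose a b := half_theta b 7 4; pose c b := half_theta b 7 3.
have e1 : jtheta 14%:Z 14%:Z * jtheta 14%:Z 6%:Z
    = a false * a false - a true * a true by apply: jthetaM_even.
have e2 : jtheta 14%:Z 14%:Z * jtheta 14%:Z 8%:Z
    = c false * c false - c true * c true by apply: jthetaM_even.
have e3 : jtheta 14%:Z 13%:Z * jtheta 14%:Z 7%:Z
    = a false * c false - a true * c true by apply: jthetaM_even.
have e4 : q ^+ 3 * (jtheta 14%:Z 7%:Z * jtheta 14%:Z 1%:Z)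
    = a true * c false - a false * c true by apply: jthetaM_odd.
move: e1 e2 e3 e4; rewrite !jt //.
move: (theta28 14) (theta28 6) (theta28 8) (theta28 13) (theta28 7) (theta28 1).
move=> t14 t6 t8 t13 t7 t1.
move: {jt} u uu (a false) (a true) (c false) (c true) => u uu a0 a1 c0 c1.
move=> e1 e2 e3 e4 {a c}.
apply: (mulIr (unitrX 4 uu)).
transitivity ((t13 * u * (t7 * u)) ^+ 2
    - (q ^+ 3 * (t7 * u * (t1 * u))) ^+ 2).
  by rewrite [(q ^+ 3 * _) ^+ 2]exprMn -exprM; ring.
rewrite e3 e4.
transitivity ((t14 * u * (t6 * u)) * (t14 * u * (t8 * u))); last by ring.
by rewrite e1 e2; ring.
Qed.

Lemma theta28_unit z : (0 < z < 28)%N -> theta28 z \is a GRing.unit.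
Proof.
move=> z_bd; rewrite unitrM !qpoch_unit // fcoefXn ltn_eqF //; lia.
Qed.

(** This is [theta28_relation] divided by [A * B], where [A] is its right-hand side and [B] the
    denominator on the right here. *)
Lemma theta28_quotients :
  (theta28 1 ^+ 2 * theta28 14 ^+ 2 * (theta28 6 * theta28 8))^-1
  - q ^+ 6 * (theta28 13 ^+ 2 * theta28 14 ^+ 2 * (theta28 6 * theta28 8))^-1
  = ((theta28 1 * theta28 7 * theta28 13) ^+ 2)^-1.
Proof.
have rel := theta28_relation.
have := (theta28_unit (z := 1) isT, theta28_unit (z := 6) isT,
  theta28_unit (z := 7) isT, theta28_unit (z := 8) isT,
  theta28_unit (z := 13) isT, theta28_unit (z := 14) isT).
move: (theta28 1) (theta28 6) (theta28 7) (theta28 8) (theta28 13) (theta28 14)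
  rel.
move: (q ^+ 6) => x t1 t6 t7 t8 t13 t14 rel [[[[[u1 u6] u7] u8] u13] u14].
pose A := t14 ^+ 2 * (t6 * t8).
have uA : A \is a GRing.unit by rewrite !unitrM u14 u6.
have relA : A = (t13 * t7) ^+ 2 - x * (t7 * t1) ^+ 2 by rewrite rel /A; ring.
pose B := (t1 * t7 * t13) ^+ 2.
have uB : B \is a GRing.unit by apply: unitrX; rewrite !unitrM u1 u7.
apply: (mulIr uB); rewrite mulVr //; apply: (mulIr uA); rewrite mul1r.
have E1 : (t1 ^+ 2 * t14 ^+ 2 * (t6 * t8))^-1 * B * A = (t13 * t7) ^+ 2.
  have -> : t1 ^+ 2 * t14 ^+ 2 * (t6 * t8) = t1 ^+ 2 * A by rewrite /A; ring.
  have uC : t1 ^+ 2 * A \is a GRing.unit by rewrite unitrM uA unitrX.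
  by rewrite -mulrA; apply: (canLR (mulKr uC)); rewrite /B; ring.
have E2 : (t13 ^+ 2 * t14 ^+ 2 * (t6 * t8))^-1 * B * A = (t7 * t1) ^+ 2.
  have -> : t13 ^+ 2 * t14 ^+ 2 * (t6 * t8) = t13 ^+ 2 * A by rewrite /A; ring.
  have uC : t13 ^+ 2 * A \is a GRing.unit by rewrite unitrM uA unitrX.
  by rewrite -mulrA; apply: (canLR (mulKr uC)); rewrite /B; ring.
by rewrite !mulrBl E1 -(mulrA x) -(mulrA x) E2 -relA.
Qed.

(* Each residue is repeated once per colour. *)
Definition D1_residues : seq nat :=
  [:: 1; 1; 27; 27; 14; 14; 14; 14; 6; 22; 8; 20].
Definition D2_residues : seq nat :=
  [:: 13; 13; 15; 15; 14; 14; 14; 14; 6; 22; 8; 20].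
Definition D3_residues : seq nat :=
  [:: 1; 1; 27; 27; 7; 7; 21; 21; 13; 13; 15; 15].

Definition residue_gf (l : seq nat) : fps int :=
  (\prod_(s <- l) qpoch (q ^+ s) (q ^+ 28))^-1.

(* [p] is kept abstract because comparing two concrete q-shifted factorials by
   conversion does not terminate in practice. *)
Lemma residue_products (R : comUnitRingType) (x : R) (p : nat -> R) :
  let t z := p z * p (28 - z)%N in
    (t 1 ^+ 2 * t 14 ^+ 2 * (t 6 * t 8))^-1
    - x * (t 13 ^+ 2 * t 14 ^+ 2 * (t 6 * t 8))^-1
    = ((t 1 * t 7 * t 13) ^+ 2)^-1 ->
  (\prod_(s <- D1_residues) p s)^-1 - x * (\prod_(s <- D2_residues) p s)^-1
  = (\prod_(s <- D3_residues) p s)^-1.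
Proof.
move=> t rel; etransitivity; last (etransitivity; first exact: rel).
  by rewrite /t !big_cons !big_nil; congr (_^-1 - _ * _^-1) => /=; ring.
by rewrite /t !big_cons !big_nil; congr (_^-1) => /=; ring.
Qed.

Lemma residue_gf_relation :
  residue_gf D1_residues - q ^+ 6 * residue_gf D2_residues
  = residue_gf D3_residues.
Proof. exact: residue_products theta28_quotients. Qed.

Lemma residue_products_grouped (R : comUnitRingType) (x : R) (p : nat -> R) :
  (\prod_(s <- D1_residues) p s)^-1 - x * (\prod_(s <- D2_residues) p s)^-1
    = (\prod_(s <- D3_residues) p s)^-1 ->
  1 / ((\prod_(s <- [:: 1; 27]%N) p s) ^+ 2 * p 14 ^+ 4
       * \prod_(s <- [:: 6; 22; 8; 20]%N) p s)
  - x / ((\prod_(s <- [:: 13; 15]%N) p s) ^+ 2 * p 14 ^+ 4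
         * \prod_(s <- [:: 6; 22; 8; 20]%N) p s)
  = 1 / (\prod_(s <- [:: 1; 27; 7; 21; 13; 15]%N) p s) ^+ 2.
Proof.
move=> rel; rewrite !div1r.
etransitivity; last (etransitivity; first exact: rel).
  by rewrite !big_cons !big_nil; congr (_^-1 - _ * _^-1); ring.
by rewrite !big_cons !big_nil; congr (_^-1); ring.
Qed.

(** Reduces the comparison of colour counts with residue multiplicities to 28 computed cases. *)
Lemma mod28_eq (f g : nat -> nat) :
  all (fun r => f r == g r) (iota 0 28) ->
  forall k, f (k %% 28)%N = g (k %% 28)%N.
Proof. by move=> /allP fg k; apply/eqP/fg; rewrite mem_iota ltn_mod. Qed.

Lemma D1_gf n : (D1 n)%:Z = fcoef (residue_gf D1_residues) n.
Proof.
apply: residue_coloured_partitions_gf => // k; rewrite /D1_colours.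
exact: (@mod28_eq (fun r => if r \in [:: 1; 27] then 2
  else if r \in [:: 6; 22; 8; 20] then 1 else if r == 14 then 4 else 0)%N
  (fun r => count_mem r D1_residues)).
Qed.

Lemma D2_gf n : (D2 n)%:Z = fcoef (residue_gf D2_residues) n.
Proof.
apply: residue_coloured_partitions_gf => // k; rewrite /D2_colours.
exact: (@mod28_eq (fun r => if r \in [:: 13; 15] then 2
  else if r \in [:: 6; 22; 8; 20] then 1 else if r == 14 then 4 else 0)%N
  (fun r => count_mem r D2_residues)).
Qed.

Lemma D3_gf n : (D3 n)%:Z = fcoef (residue_gf D3_residues) n.
Proof.
apply: residue_coloured_partitions_gf => // k; rewrite /D3_colours.
exact: (@mod28_eq (fun r => if r \in [:: 1; 27; 7; 21; 13; 15] then 2 else 0)%N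
  (fun r => count_mem r D3_residues)).
Qed.

Theorem theorem3p2 :
  (forall n : nat, (6 <= n)%N ->
     (D1 n)%:Z - (D2 (n - 6))%:Z - (D3 n)%:Z = 0)
  /\
  (let q : fps int := fpsX int in
   let Q : fps int := q ^+ 28 in
   1 / (qpochs [:: q; q ^+ 27] Q ^+ 2 * qpoch (q ^+ 14) Q ^+ 4
        * qpochs [:: q ^+ 6; q ^+ 22; q ^+ 8; q ^+ 20] Q)
   - q ^+ 6 / (qpochs [:: q ^+ 13; q ^+ 15] Q ^+ 2 * qpoch (q ^+ 14) Q ^+ 4
        * qpochs [:: q ^+ 6; q ^+ 22; q ^+ 8; q ^+ 20] Q)
   = 1 / qpochs [:: q; q ^+ 27; q ^+ 7; q ^+ 21; q ^+ 13; q ^+ 15] Q ^+ 2).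
Proof.
split=> [n le6n|q Q].
  have := congr1 (fun a => fcoef a n) residue_gf_relation.
  rewrite fcoefB fcoefXnM ltnNge le6n /= -D1_gf -D2_gf -D3_gf => ->.
  by rewrite subrr.
have := residue_products_grouped residue_gf_relation.
have qpochsE l :
    \prod_(s <- l) qpoch (q ^+ s) Q = qpochs [seq q ^+ s | s <- l] Q.
  by rewrite /qpochs big_map.
by rewrite !qpochsE.
Qed.
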